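(* Fix $\tau\in(0,1)$. Let $y_1,\dots,y_n$ be independent random variables with vector of $\tau$-quantiles $\theta^*\in\mathbb{R}^n$, whose distributions obey Assumption A. Let $K\subset\mathbb{R}^n$ be a convex set with $\theta^*\in K$, and let $$\hat\theta_K\in\arg\min_{\theta\in K}\sum_{i=1}^n\rho_\tau(y_i-\theta_i).$$ Define $\mathcal{R}:[0,\infty)\to\mathbb{R}$ by $$\mathcal{R}(t)=RW\big(K\cap\{\theta:\Delta^2(\theta-\theta^* )\le t^2\}\big).$$ Then for any $t>0$, $$\mathrm{pr}\big(\Delta^2(\hat\theta_K-\theta^* )>t^2\big)\le C\,\frac{\mathcal{R}(t)}{t^2},$$ where $C$ is a constant that depends only on the distributions of $y_1,\dots,y_n$.
   Context: Check loss: $\rho_\tau(x)=\max\{\tau x,(\tau-1)x\}$. Quantile vector: $\theta_i^*=\arg\min_{a\in\mathbb{R}}E\{\rho_\tau(y_i-a)\}$ (if $y_i$ has no first moment, this is understood through the always finite differences $E\{\rho_\tau(y_i-a)-\rho_\tau(y_i-b)\}$). $\Delta^2(v)=\sum_{i=1}^n\min\{|v_i|,v_i^2\}$ for $v\in\mathbb{R}^n$. Rademacher width: $RW(K)=E\big(\sup_{v\in K}\sum_{i=1}^n\xi_iv_i\big)$ with $\xi_1,\dots,\xi_n$ independent Rademacher variables. Assumption A: there exist constants $L>0$ and $\underline f>0$ such that for every positive integer $n$ and every $\delta\in\mathbb{R}^n$ with $\|\delta\|_\infty\le L$, $|F_{y_i}(\theta_i^*+\delta_i)-F_{y_i}(\theta_i^*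 )|\ge\underline f|\delta_i|$ for all $i=1,\dots,n$, where $F_{y_i}$ is the CDF of $y_i$. The minimizer $\hat\theta_K$ is assumed to exist. *)

(* Defs.v *)
From HB Require Import structures.
From mathcomp Require Export all_boot all_order all_algebra.
From mathcomp Require Export all_classical all_reals all_analysis.
Export Order.TTheory GRing.Theory Num.Theory.
Export numFieldNormedType.Exports.

#[export] Set Implicit Arguments.
#[export] Unset Strict Implicit.
#[export] Unset Printing Implicit Defensive.

Global Open Scope classical_set_scope.
Global Open Scope ring_scope.

Definition check_loss {R : realType} (tau x : R) : R :=
  Num.max (tau * x) ((tau - 1) * x).

(* Minimizers of the expected check loss.  The integrand is bounded, so the
   integral is finite even when mu has no first moment. *)
Definition is_quantile {R : realType} (tau : R)
    (mu : probability (measurableTypeR R) R) (a : R) : Prop :=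
  forall b : R,
    (\int[mu]_x (check_loss tau (x - a) - check_loss tau (x - b))%:E <= 0)%E.

(* The library's cdf is attached to a random variable rather than to a law. *)
Definition law_cdf {R : realType} (mu : probability (measurableTypeR R) R)
    (x : R) : R :=
  fine (mu `]-oo, x]%classic).

Definition Delta2 {R : realType} {n : nat} (v : 'rV[R]_n) : R :=
  \sum_(i < n) Num.min `|v 0 i| (v 0 i ^+ 2).

(* mu n i is the law of the i-th of n observations, theta n the corresponding
   vector of quantiles: the constants L and f do not depend on n.  The norm of
   a row vector is the library's one, i.e. the maximum norm. *)
Definition assumptionA {R : realType}
    (mu : forall n : nat, 'I_n -> probability (measurableTypeR R) R)
    (theta : forall n : nat, 'rV[R]_n) : Prop :=
  exists L f : R, 0 < L /\ 0 < f /\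
    forall n : nat, (0 < n)%N -> forall delta : 'rV[R]_n, `|delta| <= L ->
      forall i : 'I_n,
        f * `|delta 0 i| <=
        `|law_cdf (mu n i) (theta n 0 i + delta 0 i)
          - law_cdf (mu n i) (theta n 0 i)|.

(* Mutual independence of a finite family; the product rule for subfamilies is
   the case where some B i are the whole line. *)
Definition independent_RVs {R : realType} {d : measure_display}
    {T : measurableType d} (P : probability T R) {n : nat}
    (X : 'I_n -> {RV P >-> R}) : Prop :=
  forall B : 'I_n -> set R, (forall i, measurable (B i)) ->
    P [set w | forall i, B i (X i w)] =
    (\big[*%E/1%E]_(i < n) P (X i @^-1` B i))%E.

Definition rademacher_vars {R : realType} {d : measure_display}
    {T : measurableType d} (Q : probability T R) {n : nat}
    (xi : 'I_n -> {RV Q >-> R}) : Prop :=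
  independent_RVs xi /\
  forall i, Q [set w | xi i w = 1] = (2^-1)%:E /\
            Q [set w | xi i w = -1] = (2^-1)%:E.

(* The supremum is taken in \bar R, so that an unbounded supremum is +oo. *)
Definition rademacher_width {R : realType} {d : measure_display}
    {T : measurableType d} (Q : probability T R) {n : nat}
    (xi : 'I_n -> {RV Q >-> R}) (K : set 'rV[R]_n) : \bar R :=
  (\int[Q]_w ereal_sup [set (\sum_(i < n) xi i w * v 0 i)%:E | v in K])%E.

Definition argmin_on {R : realType} {T : Type} (K : set T) (f : T -> R) :
    set T :=
  [set x | K x /\ forall z, K z -> f x <= f z].

(* Main.v *)
Require Import Defs.
From mathcomp Require Import measurable_realfun ring lra.

(** If [Delta2 (theta_hat - theta) > t^2], then by convexity of [K] and of the
    check loss there is [v] in [K] with [Delta2 (v - theta) = t^2] whose empirical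
    risk does not exceed that of [theta].  When the distribution functions equal
    [tau] at the quantiles, Assumption A makes the population excess risk of [v]
    at least [c * t^2], so the centred empirical process is at least [c * t^2] at
    some point of the localized set.  The mean of its supremum is at most twice
    the Rademacher width: after discretizing the observations to finitely many
    cells this is an inequality between finite sums, obtained by replacing the
    coordinates with random signs one at a time.  Markov's inequality then gives
    the bound with a constant depending only on [L] and [f].  Otherwise the
    constant may depend on [n], and it suffices that the Rademacher width of the
    localized set is at least [t^2 / (2 n)] as soon as the event is possible. *)

(** * Sums over finite functions and decoupling by random signs *)

Definition fcons {T : Type} {n : nat} (a : T) (g : {ffun 'I_n -> T}) :
    {ffun 'I_n.+1 -> T} :=
  [ffun i => oapp g a (unlift ord0 i)].

Lemma fcons0 (T : Type) (n : nat) (a : T) (g : {ffun 'I_n -> T}) :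
  fcons a g ord0 = a.
Proof. by rewrite ffunE unlift_none. Qed.

Lemma fconsS (T : Type) (n : nat) (a : T) (g : {ffun 'I_n -> T}) (i : 'I_n) :
  fcons a g (lift ord0 i) = g i.
Proof. by rewrite ffunE liftK. Qed.

Lemma sum_ffun_recl (V : nmodType) (T : finType) (n : nat)
    (F : {ffun 'I_n.+1 -> T} -> V) :
  \sum_f F f = \sum_a \sum_g F (fcons a g).
Proof.
rewrite pair_big /=.
rewrite (reindex (fun x : T * {ffun 'I_n -> T} => fcons x.1 x.2)) //=.
exists (fun f => (f ord0, [ffun i => f (lift ord0 i)])) => [[a g] _|f _] /=.
  by rewrite fcons0; congr pair; apply/ffunP => i; rewrite ffunE fconsS.
apply/ffunP => i; case: (unliftP ord0 i) => [j ->|->].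
  by rewrite fconsS ffunE.
by rewrite fcons0.
Qed.

Lemma sum_ffun0 (V : nmodType) (T : finType) (F : {ffun 'I_0 -> T} -> V)
  (f0 : {ffun 'I_0 -> T}) : \sum_f F f = F f0.
Proof.
rewrite (bigD1 f0) //= big1 ?addr0 // => f /eqP ff0.
by case: ff0; apply/ffunP => -[].
Qed.

(* Symmetrization and contraction in one step, without a ghost sample.  To
   replace coordinate 0, let D and u be the half sum and a quarter of the
   difference of the values of h at the two signs.  The hypothesis on h gives
   [c j + (other coordinates) <= D - 2 * `|v j ord0 - u|], and the Lipschitz
   bound turns this into [... + X ord0 a (v j ord0) <= D + X ord0 a u], where the
   last term is centred and no longer depends on j. *)
Lemma decoupling (R : realFieldType) (A : finType) (J : Type) (n : nat)
    (p : 'I_n -> A -> R) (X : 'I_n -> A -> R -> R) (v : J -> 'I_n -> R)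
    (c : J -> R) (phi : {ffun 'I_n -> A} -> J) (h : {ffun 'I_n -> bool} -> R) :
  (forall i a, 0 <= p i a) -> (forall i, \sum_a p i a = 1) ->
  (forall i u, \sum_a p i a * X i a u = 0) ->
  (forall i a u u', X i a u - X i a u' <= 2 * `|u - u'|) ->
  (forall j (s : {ffun 'I_n -> bool}),
    c j + \sum_i 2 * (-1) ^+ s i * v j i <= h s) ->
  \sum_(k : {ffun 'I_n -> A}) (\prod_i p i (k i)) *
      (c (phi k) + \sum_i X i (k i) (v (phi k) i)) <=
    2^-1 ^+ n * \sum_s h s.
Proof.
elim: n p X v c phi h => [|n IH] p X v c phi h p0 p1 X0 XL hh.
  have a0 T : {ffun 'I_0 -> T} by apply: finfun => -[].
  rewrite (sum_ffun0 _ (a0 _)) (sum_ffun0 _ (a0 _)).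
  by rewrite big_ord0 !mul1r big_ord0; have := hh (phi (a0 A)) (a0 bool);
     rewrite big_ord0.
rewrite 2!sum_ffun_recl.
pose D s := (h (fcons false s) + h (fcons true s)) / 2.
pose u s := (h (fcons false s) - h (fcons true s)) / 4.
have step a : \sum_(g : {ffun 'I_n -> A})
    (\prod_i p i (fcons a g i)) * (c (phi (fcons a g)) +
      \sum_i X i (fcons a g i) (v (phi (fcons a g)) i))
    <= p ord0 a * (2^-1 ^+ n * \sum_s (D s + X ord0 a (u s))).
  have := IH (fun i => p (lift ord0 i)) (fun i => X (lift ord0 i))
    (fun j i => v j (lift ord0 i)) (fun j => c j + X ord0 a (v j ord0))
    (fun g => phi (fcons a g)) (fun s => D s + X ord0 a (u s))
    (fun i => p0 _) (fun i => p1 _) (fun i => X0 _) (fun i => XL _).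
  have hstep j (s : {ffun 'I_n -> bool}) : c j + X ord0 a (v j ord0) +
      \sum_i 2 * (-1) ^+ s i * v j (lift ord0 i) <= D s + X ord0 a (u s).
    have := hh j (fcons false s); have := hh j (fcons true s).
    rewrite !big_ord_recl !fcons0.
    have E b : \sum_(i < n) 2 * (-1) ^+ fcons b s (lift ord0 i)
        * v j (lift ord0 i) = \sum_(i < n) 2 * (-1) ^+ s i * v j (lift ord0 i).
      by apply: eq_bigr => i _; rewrite fconsS.
    rewrite !E; set S := \sum_(i < n) _.
    have := XL ord0 a (v j ord0) (u s).
    move: (X ord0 a (v j ord0)) (X ord0 a (u s)) => x y.
    rewrite /D /u /= expr0 expr1.
    move: (v j ord0) (h (fcons true s)) (h (fcons false s)) => w h1 h2.
    by have [uv|uv] := leP w ((h2 - h1) / 4);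
      [rewrite ler0_norm|rewrite gtr0_norm]; lra.
  move=> /(_ hstep) /(ler_wpM2l (p0 ord0 a)); apply: le_trans.
  rewrite mulr_sumr le_eqVlt; apply/orP; left; apply/eqP.
  apply: eq_bigr => g _; rewrite !big_ord_recl fcons0 -mulrA -addrA.
  by congr (_ * (_ * (_ + (_ + _)))); apply: eq_bigr => i _; rewrite fconsS.
apply: le_trans (ler_sum _ (fun a _ => step a)) _.
rewrite le_eqVlt; apply/orP; left; apply/eqP.
transitivity (2^-1 ^+ n * \sum_s D s).
  transitivity (2^-1 ^+ n * \sum_s \sum_a p ord0 a * (D s + X ord0 a (u s))).
    rewrite exchange_big mulr_sumr; apply: eq_bigr => a _.
    by rewrite -mulr_sumr mulrCA.
  congr (_ * _); apply: eq_bigr => s _.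
  under eq_bigr do rewrite mulrDr.
  by rewrite big_split /= X0 addr0 -mulr_suml p1 mul1r.
rewrite exprSr -mulrA; congr (_ * _).
rewrite exchange_big mulr_sumr; apply: eq_bigr => s _.
by rewrite big_bool /D addrC mulrC.
Qed.

(** * Monotone integrals and averages over sign patterns *)

(* No measurability is needed: the library's integral of a nonnegative function
   is a supremum over the simple functions below it.  This matters because the
   supremum over K in rademacher_width is uncountable. *)
Lemma integral_mono (d : measure_display) (T : measurableType d) (R : realType)
    (mu : {measure set T -> \bar R}) (f g : T -> \bar R) :
  (forall x, f x <= g x)%E -> (\int[mu]_x f x <= \int[mu]_x g x)%E.
Proof.
move=> fg; rewrite /integral !patch_setT; apply: leeB.
  apply: ge_ereal_sup => _ [h hf <-]; apply: ereal_sup_ubound; exists h => // x.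
  apply: le_trans (hf x) _; rewrite !funeposE.
  by rewrite ge_max !le_max fg lexx !orbT.
apply: ge_ereal_sup => _ [h hf <-]; apply: ereal_sup_ubound; exists h => // x.
apply: le_trans (hf x) _; rewrite !funenegE.
by rewrite ge_max !le_max leeN2 fg lexx !orbT.
Qed.

Lemma measurable_forall (d : measure_display) (T : measurableType d)
    (I : finType) (B : I -> set T) :
  (forall i, measurable (B i)) -> measurable [set w | forall i, B i w].
Proof.
move=> mB; rewrite (_ : [set w | _] = \bigcap_(i in [set: I]) B i).
  exact: fin_bigcap_measurable.
by apply/seteqP; split => [w h i _|w h i]; apply: h.
Qed.

Lemma integral_indic_sum (d : measure_display) (T : measurableType d)
    (R : realType) (P : probability T R) (I : finType) (a : I -> R)
    (E : I -> set T) : (forall i, measurable (E i)) ->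
  (\int[P]_x (\sum_i a i * \1_(E i) x)%:E = \sum_i (a i)%:E * P (E i))%E.
Proof.
move=> mE; under eq_integral do rewrite -sumEFin.
rewrite integral_sum //.
  apply: eq_bigr => i _; under eq_integral do rewrite EFinM.
  by rewrite integralZl // ?integral_indic ?setIT//; exact: integrable_indic.
move=> i; under eq_fun do rewrite EFinM.
by apply: integrableZl => //; exact: integrable_indic.
Qed.

(** Choosing the point [v s] according to the observed signs gives a measurable function below the
    supremum, and the integral of that function is a finite average. *)
Lemma rademacher_width_ge (R : realType) (d : measure_display)
    (T : measurableType d) (Q : probability T R) (n : nat)
    (xi : 'I_n -> {RV Q >-> R}) (K : set 'rV[R]_n)
    (v : {ffun 'I_n -> bool} -> 'rV[R]_n) :
  rademacher_vars xi -> (forall s, K (v s)) ->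
  ((2^-1 ^+ n * \sum_(s : {ffun 'I_n -> bool}) \sum_i (-1) ^+ s i * v s 0 i)%:E <=
   rademacher_width xi K)%E.
Proof.
move=> [ind half] Kv.
(* The events [S s] partition the whole space, the events [E s] only almost all of it. Hence [g],
   built on [S], is below the supremum at every point, while [q], built on [E], equals [g] almost
   everywhere and has an explicit integral. *)
have mxi i (B : set R) : measurable B -> measurable (xi i @^-1` B).
  by move=> mB; rewrite -[X in measurable X]setTI; exact: measurable_funP.
pose S (s : {ffun 'I_n -> bool}) := [set w | forall i, (xi i w == 1) = ~~ s i].
have mS s : measurable (S s).
  apply: (@measurable_forall _ _ _
    (fun i => xi i @^-1` [set x | (x == 1) = ~~ s i])) => i; apply: mxi.
  case: (s i) => /=.
    rewrite (_ : [set x | _] = ~` [set 1]); first exact: measurableC.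
    by apply/seteqP; split => x /=; case: eqP.
  rewrite (_ : [set x | _] = [set 1]) //.
  by apply/seteqP; split => x /=; case: eqP.
pose E (s : {ffun 'I_n -> bool}) := [set w | forall i, xi i w = (-1) ^+ s i].
have mE s : measurable (E s).
  by apply: (@measurable_forall _ _ _
    (fun i => xi i @^-1` [set (-1) ^+ s i])) => i; apply: mxi.
have PE s : Q (E s) = (2^-1 ^+ n)%:E.
  rewrite /E (ind (fun i => [set (-1) ^+ s i])) //.
  rewrite (eq_bigr (fun=> (2^-1)%:E)) => [|i _].
    by rewrite prodEFin prodr_const card_ord.
  by have [h1 h2] := half i; case: (s i).
pose a (s : {ffun 'I_n -> bool}) := \sum_i (-1) ^+ s i * v s 0 i.
pose q w : R := \sum_(s : {ffun 'I_n -> bool}) a s * \1_(E s) w.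
pose g w : R := \sum_(s : {ffun 'I_n -> bool}) (\sum_i xi i w * v s 0 i) * \1_(S s) w.
have aexi : {ae Q, forall w, forall i, xi i w = 1 \/ xi i w = -1}.
  apply: filter_forall => i.
  have mB : measurable (xi i @^-1` [set 1] `|` xi i @^-1` [set -1]).
    by apply: measurableU; apply: mxi.
  exists (~` (xi i @^-1` [set 1] `|` xi i @^-1` [set -1])); split => //.
  - exact: measurableC.
  - rewrite probability_setC // measureU; [|exact: mxi|exact: mxi|].
      have [h1 h2] := half i.
      transitivity (1 - ((2^-1)%:E + (2^-1)%:E) : \bar R)%E.
        by congr (_ - (_ + _))%E.
      by rewrite -!EFinD; congr EFin; lra.
    apply/seteqP; split => // w [/= -> /eqP].
    by rewrite -addr_eq0 (_ : 1 + 1 = 2%:R) // pnatr_eq0.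
have mg : measurable_fun setT g.
  apply: measurable_sum => s; apply: measurable_funM.
    by apply: measurable_sum => i; apply: measurable_funM.
  exact: measurable_indic.
have mq : measurable_fun setT q.
  apply: measurable_sum => s; apply: measurable_funM => //.
have -> : (2^-1 ^+ n * \sum_(s : {ffun 'I_n -> bool}) \sum_i (-1) ^+ s i * v s 0 i)%:E =
    (\int[Q]_w (g w)%:E)%E.
  transitivity (\int[Q]_w (q w)%:E)%E.
    rewrite integral_indic_sum // mulr_sumr -sumEFin; apply: eq_bigr => s _.
    by rewrite PE -EFinM mulrC.
  apply: ae_eq_integral => //; try exact/measurable_EFinP.
  apply: filterS aexi => w hw _; congr EFin; apply: eq_bigr => s _.
  rewrite !indicE; have [wE|wE] := pselect (E s w).
    rewrite (mem_set wE) mem_set; last first.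
      move=> i; rewrite wE; case: (s i); rewrite /= ?eqxx //.
      by apply/negbTE; rewrite eq_sym -addr_eq0 (_ : 1 + 1 = 2%:R) // pnatr_eq0.
    by congr (_ * _); apply: eq_bigr => i _; rewrite wE.
  rewrite memNset // [w \in _]memNset ?mulr0 // => wS; apply: wE => i.
  have := wS i; case: (hw i) => ->; case: (s i) => //=; rewrite ?eqxx //.
  by move=> /eqP /esym.
apply: integral_mono => w; apply: ereal_sup_ubound.
pose s0 := [ffun i => xi i w != 1].
exists (v s0); first exact: Kv.
congr EFin; rewrite /g (bigD1 s0) //= [X in _ + X]big1 ?addr0.
  rewrite indicE mem_set ?mulr1 // => i; by rewrite ffunE negbK.
move=> s ss0; rewrite indicE memNset ?mulr0 // => wS.
by move/eqP: ss0; apply; apply/ffunP => i; rewrite ffunE wS negbK.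
Qed.

(** * Pointwise properties of the check loss *)

Lemma check_lossE (R : realType) (tau x : R) :
  check_loss tau x = tau * x + Num.max 0 (- x).
Proof.
by rewrite /check_loss mulrBl mul1r addr_maxr addr0.
Qed.

Lemma check_loss_lipschitz (R : realType) (tau x y : R) :
  0 <= tau <= 1 -> `|check_loss tau x - check_loss tau y| <= `|x - y|.
Proof.
move=> /andP[t0 t1].
wlog yx : x y / y <= x => [H|].
  by have [/H//|/ltW/H] := leP y x; rewrite distrC [leRHS]distrC.
rewrite (ger0_norm (x := x - y)) ?subr_ge0 // ler_norml !check_lossE.
have h1 : 0 <= tau * (x - y) by rewrite mulr_ge0 ?subr_ge0.
have h2 : 0 <= (1 - tau) * (x - y) by rewrite mulr_ge0 ?subr_ge0.
by apply/andP; split; case: (leP 0 (- x)); case: (leP 0 (- y)) => *; lra.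
Qed.

Lemma check_loss_convex (R : realType) (tau s x y : R) : 0 <= s <= 1 ->
  check_loss tau (s * x + (1 - s) * y) <=
  s * check_loss tau x + (1 - s) * check_loss tau y.
Proof.
move=> /andP[s0 s1]; rewrite {1}/check_loss ge_max.
have s1' : 0 <= 1 - s by rewrite subr_ge0.
have A z : tau * z <= check_loss tau z by rewrite le_max lexx.
have B z : (tau - 1) * z <= check_loss tau z by rewrite le_max lexx orbT.
apply/andP; split; rewrite mulrDr mulrCA [X in _ + X]mulrCA; apply: lerD;
  by apply: ler_wpM2l.
Qed.

(* Two-step minorants of the check loss increments, so that their means only
   involve the distribution function at two points. *)
Lemma check_loss_diff_lb_pos (R : realType) (tau x d : R) : 0 <= d ->
  d / 2 * ((x <= 0)%R)%:R + d / 2 * ((x <= d / 2)%R)%:R - tau * d <=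
  check_loss tau (x - d) - check_loss tau x.
Proof.
move=> d0; rewrite !check_lossE.
case: (leP 0 (- (x - d))); case: (leP 0 (- x)); case: (leP x 0);
  case: (leP x (d / 2)) => *; rewrite ?mulr1 ?mulr0; lra.
Qed.

Lemma check_loss_diff_lb_neg (R : realType) (tau x d : R) : 0 <= d ->
  tau * d - d / 2 * ((x <= 0)%R)%:R - d / 2 * ((x <= - (d / 2))%R)%:R <=
  check_loss tau (x + d) - check_loss tau x.
Proof.
move=> d0; rewrite !check_lossE.
case: (leP 0 (- (x + d))); case: (leP 0 (- x)); case: (leP x 0);
  case: (leP x (- (d / 2))) => *; rewrite ?mulr1 ?mulr0; lra.
Qed.

(** * Discretization of the observations *)

Definition clamp {R : realType} (M y : R) : R := Num.max (- M) (Num.min M y).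

Lemma clamp_itv (R : realType) (M y : R) : 0 <= M -> - M <= clamp M y <= M.
Proof.
move=> M0; rewrite /clamp le_max lexx /= ge_max ge_min lexx.
by rewrite (le_trans _ M0) // oppr_le0.
Qed.

(** For [y] beyond [M] in absolute value both residuals have the same sign, so the loss is linear
    there and the increment no longer depends on [y]. *)
Lemma check_loss_diff_clamp (R : realType) (tau M y u v : R) :
  `|u| <= M -> `|v| <= M ->
  check_loss tau (y - u) - check_loss tau (y - v) =
  check_loss tau (clamp M y - u) - check_loss tau (clamp M y - v).
Proof.
rewrite !ler_norml => /andP[u1 u2] /andP[v1 v2]; rewrite !check_lossE /clamp.
have P (w z : R) : w <= z -> Num.max 0 (- (z - w)) = 0.
  by move=> wz; apply/max_idPl; lra.
have N (w z : R) : z <= w -> Num.max 0 (- (z - w)) = w - z.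
  by move=> wz; rewrite opprB; apply/max_idPr; lra.
have [My|yM] := leP M y.
  rewrite (max_idPr (_ : - M <= M)); last lra.
  by rewrite !P ?(le_trans _ My) //; lra.
have [My|My] := leP (- M) y; first by [].
by rewrite !N ?(le_trans (ltW My)) //; lra.
Qed.

(** The cells are those of a grid of mesh [eta] on the clamped line; the two tails fall into the end
    cells, so finitely many cells suffice. *)
Lemma finite_partition (R : realType) (M eta : R) : 0 <= M -> 0 < eta ->
  exists (N : nat) (kappa : R -> 'I_N.+1),
    (forall k, measurable (kappa @^-1` [set k])) /\
    forall y y', kappa y = kappa y' -> `|clamp M y - clamp M y'| <= eta.
Proof.
move=> M0 eta0; pose phi y := (clamp M y + M) / eta.
have phi0 y : 0 <= phi y.
  by have /andP[h1 h2] := clamp_itv y M0; rewrite divr_ge0 ?(ltW eta0)//; lra.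
have phiM y : phi y <= (M + M) / eta.
  by have /andP[h1 h2] := clamp_itv y M0; rewrite ler_pM2r ?invr_gt0//; lra.
pose N := Num.truncn ((M + M) / eta).
have tN y : (Num.truncn (phi y) < N.+1)%N by rewrite ltnS le_truncn.
exists N, (fun y => inord (Num.truncn (phi y))); split => [k|y y'].
  rewrite (_ : _ @^-1` _ = phi @^-1` `[k%:R, k.+1%:R[%classic).
    have mphi : measurable_fun setT phi.
      apply: measurable_funM => //; apply: measurable_funD => //.
      by apply: measurable_maxr => //; apply: measurable_minr.
    by rewrite -[X in measurable X]setTI; exact: mphi.
  apply/seteqP; split => y /=.
    move=> <-; rewrite inordK // in_itv /=; exact: truncn_itv.
  rewrite in_itv /= => h; apply/val_inj => /=.
  by rewrite inordK //; exact: truncn_def.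
move=> /(congr1 val); rewrite /= !inordK // => e.
have := truncn_itv (phi0 y); have := truncn_itv (phi0 y'); rewrite e.
rewrite -natr1 => /andP[a1 a2] /andP[b1 b2].
have : `|phi y - phi y'| <= 1 by rewrite ler_norml; apply/andP; split; lra.
rewrite -mulrBl opprD addrACA subrr addr0 normrM (gtr0_norm (_ : 0 < eta^-1)).
  by rewrite ler_pdivrMr ?mul1r.
by rewrite invr_gt0.
Qed.

(** * Growth of the mean check loss around the quantile *)

Lemma sum_prob_mono (d : measure_display) (T : measurableType d)
    (R : realType) (P : probability T R) (I J : finType) (a : I -> R)
    (b : J -> R) (E : I -> set T) (F : J -> set T) :
  (forall i, measurable (E i)) -> (forall j, measurable (F j)) ->
  (forall x, \sum_j b j * \1_(F j) x <= \sum_i a i * \1_(E i) x) ->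
  \sum_j b j * fine (P (F j)) <= \sum_i a i * fine (P (E i)).
Proof.
move=> mE mF FE.
have toE (H : finType) (h : H -> R) (G : H -> set T) :
    (forall i, measurable (G i)) -> (\sum_i h i * fine (P (G i)))%:E =
    (\int[P]_x (\sum_i h i * \1_(G i) x)%:E)%E.
  move=> mG; rewrite integral_indic_sum // -sumEFin; apply: eq_bigr => i _.
  by rewrite EFinM fineK // fin_num_measure.
rewrite -lee_fin !toE //; apply: integral_mono => x; rewrite lee_fin; exact: FE.
Qed.

Lemma law_cdf_mono (R : realType) (mu : probability (measurableTypeR R) R)
    (x y : R) : x <= y -> law_cdf mu x <= law_cdf mu y.
Proof.
move=> xy; apply: fine_le; rewrite ?fin_num_measure //.
by apply: le_measure; rewrite ?inE //; apply: subset_itvl; rewrite bnd_simp.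
Qed.

(** Monotonicity of the distribution function resolves the absolute value and carries the bound at
    distance [Num.min s L] over to every [s]. *)
Lemma law_cdf_growth (R : realType) (mu : probability (measurableTypeR R) R)
    (th L f s : R) : 0 < L -> 0 <= s ->
  (forall u, `|u| <= L ->
    f * `|u| <= `|law_cdf mu (th + u) - law_cdf mu th|) ->
  f * Num.min s L <= law_cdf mu (th + s) - law_cdf mu th /\
  f * Num.min s L <= law_cdf mu th - law_cdf mu (th - s).
Proof.
move=> L0 s0 H; set m := Num.min s L.
have m0 : 0 <= m by rewrite le_min s0 ltW.
have ms : m <= s by rewrite ge_min lexx.
have mL : `|m| <= L by rewrite ger0_norm // ge_min lexx orbT.
split.
  apply: (@le_trans _ _ (law_cdf mu (th + m) - law_cdf mu th)).
    rewrite -[X in f * X]ger0_norm // (le_trans (H _ mL)) // ger0_norm //.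
    by rewrite subr_ge0 law_cdf_mono // lerDl.
  by rewrite lerD2r law_cdf_mono // lerD2l.
apply: (@le_trans _ _ (law_cdf mu th - law_cdf mu (th - m))).
  rewrite -[X in f * X]ger0_norm // -normrN (le_trans (H (- m) _)) ?normrN //.
  by rewrite distrC ger0_norm // subr_ge0 law_cdf_mono // gerDl oppr_le0.
by rewrite lerD2l lerN2 law_cdf_mono // lerD2l lerN2.
Qed.

(** After dividing by [d * f / 2], the claim is that [Num.min 2^-1 L * Num.min 1 d] is at most both
    [d / 2] and [L]. This is where the constant of the tail bound arises. *)
Lemma huber_growth (R : realType) (L f d : R) : 0 < L -> 0 < f -> 0 <= d ->
  f / 2 * Num.min 2^-1 L * Num.min d (d ^+ 2) <= d / 2 * (f * Num.min (d / 2) L).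
Proof.
move=> L0 f0 d0; set c := Num.min 2^-1 L.
have -> : d / 2 * (f * Num.min (d / 2) L) = f / 2 * (d * Num.min (d / 2) L).
  by ring.
rewrite -mulrA ler_pM2l ?divr_gt0 // expr2.
have -> : Num.min d (d * d) = d * Num.min 1 d by rewrite minr_pMr // mulr1.
rewrite mulrCA ler_wpM2l // le_min.
have c0 : 0 <= c by rewrite le_min invr_ge0 ler0n ltW.
have [c1 c2] : c <= 2^-1 /\ c <= L by rewrite !ge_min !lexx orbT.
have m0 : 0 <= Num.min 1 d by rewrite le_min ler01.
have [m1 m2] : Num.min 1 d <= 1 /\ Num.min 1 d <= d by rewrite !ge_min !lexx orbT.
apply/andP; split.
  by rewrite mulrC ler_pM.
by rewrite -[L]mulr1 ler_pM.
Qed.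

(** With d the distance from [th] to [u], the two-step minorant has mean d/2 times the sum of the
    deviations of the distribution function from [tau] at [th] and at distance d/2 from it. The
    first is 0, the second is bounded by [law_cdf_growth]. The slack [eta] absorbs the
    discretization. *)
Lemma mean_check_loss_ge (R : realType)
    (mu : probability (measurableTypeR R) R) (A : finType) (kappa : R -> A)
    (q : A -> R) (tau th u L f eta : R) :
  0 < L -> 0 < f ->
  (forall a, measurable (kappa @^-1` [set a])) ->
  (forall y, check_loss tau (y - u) - check_loss tau (y - th) - eta
             <= q (kappa y)) ->
  law_cdf mu th = tau ->
  (forall v, `|v| <= L ->
    f * `|v| <= `|law_cdf mu (th + v) - law_cdf mu th|) ->
  f / 2 * Num.min 2^-1 L * Num.min `|u - th| ((u - th) ^+ 2) - eta <=
  \sum_a fine (mu (kappa @^-1` [set a])) * q a.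
Proof.
move=> L0 f0 mk hq Fth hF.
(* Integrates a step function lying below [q] on every cell; ['I_3] indexes the whole line and the
   two half-lines. *)
have key (al be x y : R) :
    (forall w, al + be * ((w <= x)%R)%:R + be * ((w <= y)%R)%:R <= q (kappa w)) ->
    al + be * law_cdf mu x + be * law_cdf mu y <=
    \sum_a fine (mu (kappa @^-1` [set a])) * q a.
  move=> h; under eq_bigr do rewrite mulrC.
  have := @sum_prob_mono _ _ _ mu A 'I_3 q
    (fun j => if j == 0 :> nat then al else be)
    (fun a => kappa @^-1` [set a])
    (fun j : 'I_3 => if j == 0 :> nat then setT else
      if j == 1 :> nat then `]-oo, x]%classic else `]-oo, y]%classic).
  rewrite !big_ord_recl big_ord0 /= probability_setT /= mulr1 addr0 addrA.
  apply => //.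
    by move=> j; case: ifP => // _; case: ifP.
  move=> w; rewrite !big_ord_recl big_ord0 /= addr0 addrA indicT mulr1.
  rewrite (bigD1 (kappa w)) //= [X in _ <= _ + X]big1; last first.
    move=> a; rewrite indicE => aw; rewrite memNset ?mulr0 //.
    by move=> /= e; rewrite -e eqxx in aw.
  have -> : \1_(kappa @^-1` [set kappa w]) w = 1 :> R.
    by rewrite indicE mem_set.
  rewrite addr0 mulr1; apply: le_trans (h w).
  have E z : \1_(`]-oo, z]%classic) w = ((w <= z)%R)%:R :> R.
    by rewrite indicE; congr (nat_of_bool _)%:R; apply/idP/idP;
       rewrite inE /= in_itv.
  by rewrite !E.
have [ut|ut] := leP th u.
  pose d := u - th; have d0 : 0 <= d by rewrite subr_ge0.
  have d20 : 0 <= d / 2 by rewrite divr_ge0.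
  apply: le_trans (key (- (tau * d) - eta) (d / 2) th (th + d / 2) _); last first.
    move=> w; apply: le_trans (hq w); rewrite -/d.
    have := check_loss_diff_lb_pos tau (w - th) d0.
    rewrite (_ : w - th - d = w - u); last by rewrite /d; ring.
    by rewrite subr_le0 (_ : (w - th <= _) = (w <= th + d / 2)) ?lerBlDl//; lra.
  rewrite ger0_norm // -/d.
  have [+ _] := law_cdf_growth L0 d20 hF; move=> /(ler_wpM2l d20).
  have := huber_growth L0 f0 d0; rewrite Fth; lra.
pose d := th - u; have d0 : 0 <= d by rewrite subr_ge0 ltW.
have d20 : 0 <= d / 2 by rewrite divr_ge0.
apply: le_trans (key (tau * d - eta) (- (d / 2)) th (th - d / 2) _); last first.
  move=> w; apply: le_trans (hq w); rewrite -/d.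
  have := check_loss_diff_lb_neg tau (w - th) d0.
  rewrite (_ : w - th + d = w - u); last by rewrite /d; ring.
  by rewrite subr_le0 (_ : (w - th <= _) = (w <= th - d / 2)) ?lerBlDl//; lra.
rewrite distrC -sqrrN opprB ger0_norm // -/d.
have [_ +] := law_cdf_growth L0 d20 hF; move=> /(ler_wpM2l d20).
have := huber_growth L0 f0 d0; rewrite Fth; lra.
Qed.

(** * Segments in [K] and localization by [Delta2] *)

Lemma convex_segment (R : realType) (n : nat) (K : set 'rV[R]_n)
    (x y : 'rV[R]_n) (s : R) :
  convex_set (K : set (convex_lmodType 'rV[R]_n)) -> K x -> K y -> 0 <= s <= 1 ->
  K (x + s *: (y - x)).
Proof.
move=> cK Kx Ky /andP[s0 s1].
have := cK y x (Itv01 s0 s1); rewrite !inE => /(_ Ky Kx).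
congr (K _); rewrite /conv /= /unstable.onem scalerBl scale1r scalerBr.
by rewrite addrC -addrA [in LHS](addrC _ (s *: y)).
Qed.

Lemma Delta2_0 (R : realType) (n : nat) : Delta2 (0 : 'rV[R]_n) = 0.
Proof.
by rewrite /Delta2 big1 // => i _; rewrite mxE normr0 expr0n minxx.
Qed.

Lemma Delta2_continuous (R : realType) (n : nat) (d : 'rV[R]_n) :
  continuous (fun s : R => Delta2 (s *: d)).
Proof.
move=> s; rewrite /Delta2.
apply: cvg_big => [|i _]; first exact: add_continuous.
under eq_fun do rewrite mxE.
rewrite mxE.
apply: (@continuous_min _ _ (fun s : R => `|s * d 0 i| : R^o)
  (fun s => (s * d 0 i) ^+ 2 : R^o) s).
  apply: continuous_comp; last exact: norm_continuous.
  exact: mulrr_continuous.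
apply: (@continuous_comp _ _ _ (fun s : R => s * d 0 i) (fun s : R => s ^+ 2)).
  exact: mulrr_continuous.
exact: exprn_continuous.
Qed.

Lemma Delta2_boundary (R : realType) (n : nat) (d : 'rV[R]_n) (r : R) :
  0 <= r -> r <= Delta2 d -> exists2 s : R, 0 <= s <= 1 & Delta2 (s *: d) = r.
Proof.
move=> r0 rd.
have [] := @IVT R (fun s : R => Delta2 (s *: d)) 0 1 r ler01.
- exact/continuous_subspaceT/Delta2_continuous.
- rewrite scale0r scale1r.
  by rewrite Delta2_0 ge_min r0 le_max rd orbT.
by move=> s; rewrite in_itv => /= s01 e; exists s.
Qed.

(** Either the minimum is [|d 0 i|] itself, or the square is smaller and then [|d 0 i|] is at most
    1. This makes the localized sets bounded in every coordinate. *)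
Lemma Delta2_coord (R : realType) (n : nat) (d : 'rV[R]_n) (i : 'I_n) :
  `|d 0 i| <= 1 + Delta2 d.
Proof.
have m0 j : 0 <= Num.min `|d 0 j| (d 0 j ^+ 2) by rewrite le_min normr_ge0 sqr_ge0.
have : Num.min `|d 0 i| (d 0 i ^+ 2) <= Delta2 d.
  by rewrite /Delta2 (bigD1 i) //= lerDl sumr_ge0.
have : 0 <= Delta2 d by rewrite sumr_ge0.
rewrite -real_normK ?num_real //; move: `|d 0 i| (normr_ge0 (d 0 i)) => a a0.
case: (leP a (a ^+ 2)) => [_|aa] D0 Da; first by rewrite (le_trans Da) // lerDr.
suff : a <= 1 by move=> /le_trans; apply; rewrite lerDl.
rewrite leNgt; apply/negP => a1; move: aa; rewrite ltNge expr2.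
by rewrite ler_peMl // ltW.
Qed.

Lemma Delta2_ball_bound (R : realType) (n : nat) (r : R) (v y : 'rV[R]_n)
    (i : 'I_n) :
  Delta2 (v - y) <= r -> `|v 0 i| <= \sum_j `|y 0 j| + (1 + r).
Proof.
move=> vr; have := Delta2_coord (v - y) i.
have : `|y 0 i| <= \sum_j `|y 0 j| by rewrite (bigD1 i) //= lerDl sumr_ge0.
have := ler_normD (y 0 i) ((v - y) 0 i).
rewrite (_ : y 0 i + _ = v 0 i); last by rewrite !mxE; ring.
by lra.
Qed.

Lemma measurable_Delta2 (R : realType) (d : measure_display)
    (T : measurableType d) (n : nat) (x : T -> 'rV[R]_n) (y : 'rV[R]_n) :
  (forall i, measurable_fun setT (fun w => x w 0 i)) ->
  measurable_fun setT (fun w => Delta2 (x w - y)).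
Proof.
move=> mx; apply: measurable_sum => i.
have m1 : measurable_fun setT (fun w => (x w - y) 0 i).
  by under eq_fun do rewrite !mxE; exact: measurable_funB.
apply: measurable_minr; first exact: measurableT_comp.
exact: measurable_funX.
Qed.

Lemma measurable_Delta2_gt (R : realType) (d : measure_display)
    (T : measurableType d) (n : nat) (x : T -> 'rV[R]_n) (y : 'rV[R]_n) (r : R) :
  (forall i, measurable_fun setT (fun w => x w 0 i)) ->
  measurable [set w | r < Delta2 (x w - y)].
Proof.
move=> mx; have := measurable_Delta2 y mx.
move=> /(_ measurableT `]r, +oo[%classic (measurable_itv _)); rewrite setTI.
by congr measurable; apply/seteqP; split => w /=; rewrite in_itv /= andbT.
Qed.

(** * Lower bounds for the Rademacher width *)

(** The majorant [h] stands for the suprema at each sign pattern, which need not be attained; points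
    within [e] of them are fed to [rademacher_width_ge]. *)
Lemma rademacher_width_ge_sup (R : realType) (d : measure_display)
    (T : measurableType d) (Q : probability T R) (n : nat)
    (xi : 'I_n -> {RV Q >-> R}) (K : set 'rV[R]_n) (M x : R) :
  rademacher_vars xi -> K !=set0 -> (forall v, K v -> forall i, `|v 0 i| <= M) ->
  (forall h : {ffun 'I_n -> bool} -> R,
    (forall v (s : {ffun 'I_n -> bool}), K v -> \sum_i (-1) ^+ s i * v 0 i <= h s) ->
    x <= 2^-1 ^+ n * \sum_s h s) ->
  (x%:E <= rademacher_width xi K)%E.
Proof.
move=> hxi [v0 Kv0] KM hx.
pose B (s : {ffun 'I_n -> bool}) := [set \sum_i (-1) ^+ s i * v 0 i | v in K].
have Bsup s : has_sup (B s).
  split; first by exists (\sum_i (-1) ^+ s i * v0 0 i), v0.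
  exists (\sum_(i < n) M) => _ [v Kv <-]; apply: ler_sum => i _.
  by rewrite (le_trans (ler_norm _)) // normrM normrX normrN1 expr1n mul1r KM.
apply/lee_addgt0Pr => e e0.
have near (s : {ffun 'I_n -> bool}) :
    exists v, K v /\ sup (B s) <= \sum_i (-1) ^+ s i * v 0 i + e.
  have [_ [v Kv <-] ve] := sup_adherent e0 (Bsup s).
  by exists v; split => //; rewrite -lerBlDr ltW.
have [v vP] := choice near.
have := rademacher_width_ge hxi (fun s => (vP s).1).
move=> /(leeD2r e%:E); apply: le_trans; rewrite -EFinD lee_fin.
apply: le_trans (hx (fun s : {ffun 'I_n -> bool} =>
  \sum_i (-1) ^+ s i * v s 0 i + e) _) _.
  move=> u s Ku; apply: le_trans (vP s).2; apply: ub_le_sup; last by exists u.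
  exact: (Bsup s).2.
rewrite big_split /= mulrDr lerD2l sumr_const card_ffun card_bool card_ord.
by rewrite -[e *+ _]mulr_natl mulrA natrX -exprMn mulVf ?pnatr_eq0 // expr1n mul1r.
Qed.

(** Decoupling with fair coins as data and only the two points [x] and [y]: the selector takes [y]
    when the coin at [i0] has the sign of [dl], gaining [2 * |dl|] with probability one half, and
    otherwise [x], gaining 0. *)
Lemma rademacher_avg_ge_coord (R : realType) (n : nat) (i0 : 'I_n)
    (x y : 'I_n -> R) (h : {ffun 'I_n -> bool} -> R) :
  (forall s : {ffun 'I_n -> bool}, \sum_i (-1) ^+ s i * x i <= h s) ->
  (forall s : {ffun 'I_n -> bool}, \sum_i (-1) ^+ s i * y i <= h s) ->
  `|y i0 - x i0| <= 2 * (2^-1 ^+ n * \sum_s h s).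
Proof.
move=> hx hy; set dl := y i0 - x i0.
pose X i (b : bool) u := if i == i0 then 2 * ((-1) ^+ b * (u - x i0)) else 0.
have X0 i u : \sum_b 2^-1 * X i b u = 0.
  by rewrite big_bool /X /=; case: eqP => _; rewrite ?expr0 ?expr1; lra.
have XL i b u u' : X i b u - X i b u' <= 2 * `|u - u'|.
  rewrite /X; case: eqP => _; last by rewrite subrr mulr_ge0.
  rewrite -mulrBr ler_pM2l // -mulrBr opprB addrA subrK.
  by rewrite (le_trans (ler_norm _)) // normrM normrX normrN1 expr1n mul1r.
have half1 : \sum_(b : bool) (2^-1 : R) = 1 by rewrite big_bool /=; lra.
have hb (j : bool) (s : {ffun 'I_n -> bool}) :
    0 + \sum_i 2 * (-1) ^+ s i * (if j then y else x) i <= 2 * h s.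
  rewrite add0r; under eq_bigr do rewrite -mulrA.
  by rewrite -mulr_sumr ler_pM2l //; case: j.
rewrite mulrCA mulr_sumr.
have := @decoupling R bool bool n (fun _ _ => 2^-1) X
  (fun j => if j then y else x) (fun=> 0) (fun k => k i0 == (dl < 0))
  (fun s => 2 * h s) (fun _ _ => ltac:(by [])) (fun _ => half1) X0 XL hb.
apply: le_trans.
(* Coin weights restricted to a matching coin at [i0]: as a product of sums, [|dl|] expands over the
   coin patterns and can be compared term by term. *)
pose F i b : R := 2^-1 * (if i == i0 then (b == (dl < 0))%:R else 1).
have -> : `|dl| = 2 * `|dl| * \prod_i \sum_b F i b.
  rewrite (bigD1 i0) //= [X in _ * (_ * X)]big1 => [|i /negbTE ii0].
    by rewrite big_bool /F eqxx /=; case: (dl < 0) => /=; lra.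
  by rewrite big_bool /F ii0 /=; lra.
rewrite bigA_distr_bigA mulr_sumr; apply: ler_sum => k _.
rewrite add0r [\sum_i _](bigD1 i0) //= [X in _ <= _ * (_ + X)]big1 ?addr0; last first.
  by move=> i /negbTE ii0; rewrite /X ii0.
rewrite /F big_split /= [X in _ * (_ * X)](bigD1 i0) //= eqxx.
rewrite [X in _ * (_ * (_ * X))]big1 ?mulr1; last by move=> i /negbTE ->.
rewrite mulrCA; apply: ler_wpM2l; first by apply: prodr_ge0.
rewrite /X eqxx; have [->|_] := eqVneq (k i0) (dl < 0); last first.
  by rewrite subrr !mulr0.
rewrite mulr1 ler_pM2l // -/dl.
have [d0|d0] := ltP dl 0; first by rewrite ltr0_norm // expr1 mulN1r.
by rewrite ger0_norm // expr0 mul1r.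
Qed.

(** * Tail bound when the distribution functions equal [tau] at the quantiles *)

Lemma sum_prob_cells (d : measure_display) (T : measurableType d)
    (R : realType) (P : probability T R) (A : finType) (kappa : T -> A) :
  (forall a, measurable (kappa @^-1` [set a])) ->
  \sum_a fine (P (kappa @^-1` [set a])) = 1.
Proof.
move=> mk.
have E x : \sum_a 1 * \1_(kappa @^-1` [set a]) x =
           \sum_(j < 1) 1 * \1_[set: T] x :> R.
  rewrite (bigD1 (kappa x)) //= big1 => [|a /eqP ak].
    by rewrite addr0 big_ord1 indicT indicE mem_set.
  by rewrite indicE memNset ?mulr0 // => /esym.
have S : \sum_(j < 1) 1 * fine (P [set: T]) = 1.
  by rewrite big_ord1 probability_setT mulr1.
transitivity (\sum_a 1 * fine (P (kappa @^-1` [set a]))).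
  by apply: eq_bigr => a _; rewrite mul1r.
rewrite -[RHS]S.
pose cells a := kappa @^-1` [set a].
apply/le_anti/andP; split.
  apply: (@sum_prob_mono _ _ R P 'I_1 A (fun=> 1) (fun=> 1) (fun=> [set: T])
    cells) => // x.
  by rewrite E.
apply: (@sum_prob_mono _ _ R P A 'I_1 (fun=> 1) (fun=> 1) cells
  (fun=> [set: T])) => // x.
by rewrite E.
Qed.

(** By convexity the excess risk at fraction [s] of the segment is at most [s] times that of [hat],
    which is nonpositive by minimality; the intermediate value theorem provides [s]. *)
Lemma check_loss_basic (R : realType) (tau t : R) (n : nat) (Y : 'I_n -> R)
    (K : set 'rV[R]_n) (th hat : 'rV[R]_n) :
  convex_set (K : set (convex_lmodType 'rV[R]_n)) -> K th ->
  argmin_on K (fun v : 'rV[R]_n => \sum_(i < n) check_loss tau (Y i - v 0 i)) hat ->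
  t ^+ 2 < Delta2 (hat - th) ->
  exists v, [/\ K v, Delta2 (v - th) = t ^+ 2 &
    \sum_(i < n) (check_loss tau (Y i - v 0 i) -
                  check_loss tau (Y i - th 0 i)) <= 0].
Proof.
move=> cK Kth [Khat hmin] /ltW /(Delta2_boundary (sqr_ge0 t)) [s s01 sE].
exists (th + s *: (hat - th)); split.
- exact: convex_segment.
- by rewrite addrAC subrr add0r.
have := hmin th Kth; set a := \sum_i _; set b := \sum_i _ => ab.
have : \sum_(i < n) (check_loss tau (Y i - (th + s *: (hat - th)) 0 i) -
    check_loss tau (Y i - th 0 i)) <= s * a + (1 - s) * b - b.
  rewrite /a /b !mulr_sumr -big_split -sumrB; apply: ler_sum => i _ /=.
  rewrite lerD2r; apply: le_trans (check_loss_convex _ _ _ s01).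
  rewrite le_eqVlt; apply/orP; left; apply/eqP; congr check_loss.
  by rewrite !mxE; ring.
move=> /le_trans; apply.
have -> : s * a + (1 - s) * b - b = s * (a - b) by ring.
by apply: mulr_ge0_le0; [case/andP: s01|rewrite subr_le0].
Qed.

Lemma quantile_regression_tail (R : realType) (tau L f : R) (n : nat)
    (mu : 'I_n -> probability (measurableTypeR R) R) (th : 'rV[R]_n)
    (d : measure_display) (Omega : measurableType d) (P : probability Omega R)
    (y : 'I_n -> {RV P >-> R}) (K : set 'rV[R]_n) (hat : Omega -> 'rV[R]_n)
    (t : R) (h : {ffun 'I_n -> bool} -> R) :
  0 <= tau <= 1 -> 0 < L -> 0 < f ->
  (forall i, law_cdf (mu i) (th 0 i) = tau) ->
  (forall i u, `|u| <= L -> f * `|u| <=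
    `|law_cdf (mu i) (th 0 i + u) - law_cdf (mu i) (th 0 i)|) ->
  independent_RVs y ->
  (forall i B, measurable B -> distribution P (y i) B = mu i B) ->
  convex_set (K : set (convex_lmodType 'rV[R]_n)) -> K th ->
  (forall i, measurable_fun setT (fun w => hat w 0 i)) ->
  (forall w, argmin_on K
    (fun v : 'rV[R]_n => \sum_(i < n) check_loss tau (y i w - v 0 i)) (hat w)) ->
  (forall v (s : {ffun 'I_n -> bool}), K v -> Delta2 (v - th) <= t ^+ 2 ->
    \sum_i (-1) ^+ s i * v 0 i <= h s) ->
  f / 2 * Num.min 2^-1 L * t ^+ 2 *
    fine (P [set w | t ^+ 2 < Delta2 (hat w - th)]) <=
  2 * (2^-1 ^+ n * \sum_s h s).
Proof.
move=> tau01 L0 f0 Fth hF ind law cK Kth mhat hmin hh.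
set c := f / 2 * _; set r := t ^+ 2; set bad := [set w | _].
have c0 : 0 < c by rewrite mulr_gt0 ?divr_gt0 // lt_min L0 invr_gt0 ltr0n.
have r0 : 0 <= r by rewrite sqr_ge0.
pose g i x u := check_loss tau (x - u) - check_loss tau (x - th 0 i).
have gth i x : g i x (th 0 i) = 0 by rewrite /g subrr.
have gL i x u u' : g i x u - g i x u' <= `|u - u'|.
  have := check_loss_lipschitz (x - u) (x - u') tau01.
  rewrite (_ : x - u - (x - u') = u' - u); last by ring.
  by rewrite distrC (distrC u') ler_norml /g => /andP[]; lra.
pose M := \sum_i `|th 0 i| + (1 + r).
have hM v : Delta2 (v - th) <= r -> forall i, `|v 0 i| <= M.
  by move=> vr i; exact: Delta2_ball_bound.
have thM i : `|th 0 i| <= M by apply: hM; rewrite subrr Delta2_0.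
have M0 : 0 <= M by rewrite addr_ge0 ?sumr_ge0 ?addr_ge0.
apply/ler_addgt0Pr => e e0.
(* Each coordinate loses [2 * eta] in the mean and [2 * eta] in the empirical term; [n.+1] keeps the
   denominator nonzero for [n = 0]. *)
pose eta := e / (4 * n.+1%:R).
have eta0 : 0 < eta by rewrite divr_gt0 // mulr_gt0.
have neta : n%:R * (4 * eta) <= e.
  have -> : e = n.+1%:R * (4 * eta).
    have nz : 4 * n.+1%:R != 0 :> R by rewrite mulf_neq0 ?pnatr_eq0.
    by rewrite -[LHS](divfK nz) -/eta; ring.
  by rewrite ler_pM2r ?mulr_gt0 // ler_nat.
have [N [kap [mkap kapP]]] := finite_partition M0 eta0.
(* A representative of each cell; the default 0 occurs only for empty cells. *)
pose z k := xget 0 [set x | kap x = k].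
have kz x : kap (z (kap x)) = kap x.
  exact: (@xgetPex _ 0 [set x' | kap x' = kap x] (ex_intro _ x erefl)).
have gz i x u : `|u| <= M -> `|g i x u - g i (z (kap x)) u| <= 2 * eta.
  move=> uM; rewrite /g (check_loss_diff_clamp tau x uM (thM i)).
  rewrite (check_loss_diff_clamp tau (z (kap x)) uM (thM i)).
  have := kapP _ _ (esym (kz x)); 
  move: (clamp M x) (clamp M (z (kap x))) => a b ab.
  have lip v : `|check_loss tau (a - v) - check_loss tau (b - v)| <= eta.
    apply: le_trans (check_loss_lipschitz _ _ tau01) _.
    by rewrite opprB addrA subrK.
  have := lip u; have := lip (th 0 i); rewrite !ler_norml.
  by move=> /andP[h1 h2] /andP[h3 h4]; apply/andP; split; lra.
(* The check loss increments are constant outside [-M, M], so they depend on the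
   observations only through finitely many cells, up to 2 * eta. *)
pose cell w : {ffun 'I_n -> 'I_N.+1} := [ffun i => kap (y i w)].
pose p i a := fine (mu i (kap @^-1` [set a])).
have p0 i a : 0 <= p i a by rewrite fine_ge0.
have p1 i : \sum_a p i a = 1 by exact: sum_prob_cells.
pose q i a u := g i (z a) u.
pose m i u := \sum_a p i a * q i a u.
(* The sign makes a low empirical risk count as a large [X]. The factor 2 in [XL] is one Lipschitz
   constant for [m] plus one for [q]. *)
pose X i a u := m i u - q i a u.
have Xth i a : X i a (th 0 i) = 0.
  by rewrite /X /m /q gth subr0 big1 // => b _; rewrite gth mulr0.
have X0 i u : \sum_a p i a * X i a u = 0.
  under eq_bigr do rewrite mulrBr.
  by rewrite sumrB -mulr_suml p1 mul1r subrr.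
have XL i a u u' : X i a u - X i a u' <= 2 * `|u - u'|.
  have : m i u - m i u' <= `|u - u'|.
    rewrite -[leRHS]mul1r -(p1 i) /m -sumrB mulr_suml; apply: ler_sum => b _.
    rewrite -mulrBr; apply: ler_wpM2l => //; exact: gL.
  by have := gL i (z a) u' u; rewrite (distrC u') /X /q; lra.
have mge i u : `|u| <= M ->
    c * Num.min `|u - th 0 i| ((u - th 0 i) ^+ 2) - 2 * eta <= m i u.
  move=> uM; apply: (mean_check_loss_ge L0 f0 mkap _ (Fth i) (hF i)) => x.
  by have := gz i x u uM; rewrite ler_norml /q /g => /andP[_]; lra.
(* A cell is bad as soon as one of its outcomes is; the boundary point of that outcome serves the
   whole cell, at cost [2 * eta] per coordinate. Elsewhere [th] contributes 0. *)
pose Bad k := `[< exists w, bad w /\ cell w = k >].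
have wit k : exists v, [/\ K v, Delta2 (v - th) <= r &
    if Bad k then Delta2 (v - th) = r /\
      \sum_i q i (k i) (v 0 i) <= n%:R * (2 * eta)
    else v = th].
  case: (boolP (Bad k)) => [/asboolP[w [bw <-]]|_]; last first.
    by exists th; split; rewrite // subrr Delta2_0.
  have [v [Kv vr gv]] := check_loss_basic cK Kth (hmin w) bw.
  exists v; split; rewrite ?vr //; split => //.
  apply: le_trans (_ : \sum_i (g i (y i w) (v 0 i) + 2 * eta) <= _).
    apply: ler_sum => i _; rewrite /q ffunE.
    have := gz i (y i w) _ (hM v _ i); rewrite vr => /(_ (lexx _)).
    by rewrite ler_norml => /andP[]; lra.
  rewrite big_split /= sumr_const card_ord -[_ *+ n]mulr_natl gerDr; exact: gv.
have [W WP] := choice wit.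
(* By independence, the probability of the union of the bad cells, which contains [bad]. *)
pose B := \sum_k (Bad k)%:R * \prod_i p i (k i).
have cells k : P [set w | forall i, (kap @^-1` [set k i]) (y i w)] =
    (\prod_i p i (k i))%:E.
  rewrite (ind (fun i => kap @^-1` [set k i])) // -prodEFin; apply: eq_bigr => i _.
  transitivity (mu i (kap @^-1` [set k i])); first exact: (law i _ (mkap _)).
  by rewrite /p fineK // fin_num_measure //; exact: mkap.
have mcell (k : {ffun 'I_n -> 'I_N.+1}) :
    measurable [set w | forall i, (kap @^-1` [set k i]) (y i w)].
  apply: (@measurable_forall _ _ _ (fun i => y i @^-1` (kap @^-1` [set k i]))).
  by move=> i; rewrite -[X in measurable X]setTI; exact: measurable_funP.
have mbad : measurable bad by exact: measurable_Delta2_gt.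
have PB : fine (P bad) <= B.
  have := @sum_prob_mono _ _ _ P {ffun 'I_n -> 'I_N.+1} 'I_1
    (fun k => (Bad k)%:R) (fun=> 1)
    (fun k => [set w | forall i, (kap @^-1` [set k i]) (y i w)]) (fun=> bad).
  rewrite big_ord1 mul1r.
  under eq_bigr do rewrite cells.
  apply => // w; rewrite big_ord1 mul1r.
  rewrite indicE; have [bw|bw] := boolP (w \in bad); last first.
    by apply: sumr_ge0 => k _; rewrite mulr_ge0.
  rewrite (bigD1 (cell w)) //= indicE mem_set; last by move=> i; rewrite /= ffunE.
  rewrite mulr1 (_ : Bad _ = true) ?lerDl ?sumr_ge0 //.
  by apply/asboolP; exists w; split => //; rewrite inE in bw.
have prod0 k : 0 <= \prod_i p i (k i) by apply: prodr_ge0.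
have B1 : B <= 1.
  have <- : \sum_(k : {ffun 'I_n -> 'I_N.+1}) \prod_i p i (k i) = 1.
    by rewrite -bigA_distr_bigA big1.
  by apply: ler_sum => k _; rewrite -[leRHS]mul1r ler_wpM2r // lern1 leq_b1.
(* The centred process at the selected point is at least [c * r - e] on bad cells and 0 on the
   others. *)
have main : (c * r - e) * B <= 2 * (2^-1 ^+ n * \sum_s h s).
  rewrite [leRHS]mulrCA [X in _ <= _ * X]mulr_sumr.
  apply: le_trans (@decoupling R 'I_N.+1 {ffun 'I_n -> 'I_N.+1} n p X
    (fun k i => W k 0 i) (fun=> 0) id (fun s => 2 * h s) p0 p1 X0 XL _); last first.
    move=> k s; rewrite add0r; under eq_bigr do rewrite -mulrA.
    by rewrite -mulr_sumr ler_pM2l //; have [KW Wr _] := WP k; apply: hh.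
  rewrite /B mulr_sumr; apply: ler_sum => k _.
  rewrite mulrA mulrC ler_wpM2l // add0r.
  have [_ Wr] := WP k; case: (Bad k) => [[We qle]|->]; last first.
    by rewrite mulr0 big1.
  rewrite mulr1 /X sumrB.
  have : c * r - n%:R * (2 * eta) <= \sum_i m i (W k 0 i).
    rewrite -We /Delta2 mulr_sumr mulr_natl -[X in _ *+ X]card_ord -sumr_const -sumrB.
    apply: ler_sum => i _; have := mge i _ (hM _ Wr i).
    by rewrite !mxE.
  by move: neta qle; lra.
have h1 : c * r * fine (P bad) <= c * r * B.
  by rewrite ler_wpM2l // mulr_ge0 // ltW.
have h2 : e * B <= e by rewrite -[leRHS]mulr1 ler_wpM2l // ltW.
by move: main; rewrite mulrBl; lra.
Qed.

(** * The dimension-dependent bound and the conclusion *)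

(** Constant vectors let Assumption A be applied to one coordinate at a time. *)
Lemma mx_norm_const_le (R : realType) (n : nat) (u : R) :
  `|const_mx u : 'rV[R]_n| <= `|u|.
Proof.
rewrite [leLHS]mx_normrE; apply: bigmax_le => // i _.
by rewrite mxE.
Qed.

(** The sign average dominates half of each coordinate difference, hence half of their mean over the
    [n] coordinates, and each term of [Delta2] is at most the absolute difference. *)
Lemma rademacher_width_ge_Delta2 (R : realType) (d : measure_display)
    (T : measurableType d) (Q : probability T R) (n : nat)
    (xi : 'I_n -> {RV Q >-> R}) (K : set 'rV[R]_n) (x y : 'rV[R]_n) (M : R) :
  (0 < n)%N -> rademacher_vars xi ->
  (forall v, K v -> forall i, `|v 0 i| <= M) -> K x -> K y ->
  ((Delta2 (y - x) / (2 * n%:R))%:E <= rademacher_width xi K)%E.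
Proof.
move=> n0 hxi KM Kx Ky; apply: (rademacher_width_ge_sup (M := M)) => //.
  by exists x.
move=> h hh; rewrite ler_pdivrMr ?mulr_gt0 ?ltr0n //.
apply: le_trans (_ : \sum_i `|y 0 i - x 0 i| <= _).
  by apply: ler_sum => i _; rewrite !mxE ge_min lexx.
have -> : 2^-1 ^+ n * (\sum_s h s) * (2 * n%:R) =
    \sum_(i < n) 2 * (2^-1 ^+ n * \sum_s h s).
  by rewrite sumr_const card_ord -[_ *+ n]mulr_natl; ring.
by apply: ler_sum => i _; apply: (@rademacher_avg_ge_coord _ _ _ (x 0) (y 0))
  => s; apply: hh.
Qed.

Theorem theorem7 (R : realType) (tau : R) (htau0 : 0 < tau) (htau1 : tau < 1)
  (mu : forall n : nat, 'I_n -> probability (measurableTypeR R) R)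
  (theta : forall n : nat, 'rV[R]_n)
  (htheta : forall (n : nat) (i : 'I_n), is_quantile tau (mu n i) (theta n 0 i))
  (hA : assumptionA mu theta) :
  exists C : nat -> R,
    (forall n, 0 < C n) /\
    ((forall (n : nat) (i : 'I_n), law_cdf (mu n i) (theta n 0 i) = tau) ->
      forall m n, C m = C n) /\
    forall (n : nat) (hn : (0 < n)%N)
      (d : measure_display) (Omega : measurableType d)
      (P : probability Omega R) (y : 'I_n -> {RV P >-> R})
      (hind : independent_RVs y)
      (hlaw : forall (i : 'I_n) (B : set R),
         measurable B -> distribution P (y i) B = mu n i B)
      (K : set 'rV[R]_n)
      (hconv : convex_set (K : set (convex_lmodType 'rV[R]_n)))
      (hK : K (theta n))
      (theta_hat : Omega -> 'rV[R]_n)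
      (hmeas : forall i : 'I_n,
         measurable_fun setT (fun w : Omega => theta_hat w 0 i))
      (hmin : forall w : Omega,
         argmin_on K
           (fun v : 'rV[R]_n => \sum_(i < n) check_loss tau (y i w - v 0 i))
           (theta_hat w))
      (d' : measure_display) (Omega' : measurableType d')
      (Q : probability Omega' R) (xi : 'I_n -> {RV Q >-> R})
      (hxi : rademacher_vars xi)
      (t : R) (ht : 0 < t),
      (P [set w | (t ^+ 2 < Delta2 (theta_hat w - theta n))%R] <=
       (C n)%:E *
       (rademacher_width xi
          (K `&` [set v | (Delta2 (v - theta n) <= t ^+ 2)%R])
        * ((t ^+ 2)^-1)%:E))%E.
Proof.
have [L [f [L0 [f0 hLf]]]] := hA.
pose c := f / 2 * Num.min 2^-1 L.
have c0 : 0 < c by rewrite mulr_gt0 ?divr_gt0 // lt_min L0 invr_gt0 ltr0n.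
pose cont := forall (n : nat) (i : 'I_n), law_cdf (mu n i) (theta n 0 i) = tau.
(* If some law has an atom at its quantile, the quantile need not be a strict
   minimizer; there only the n-dependent bound RW >= t^2 / (2 n) is available. *)
pose C n := if `[< cont >] then 2 / c else 2 * n.+1%:R.
have C0 n : 0 < C n.
  by rewrite /C; case: ifP => _; rewrite ?divr_gt0 // mulr_gt0.
exists C; split => //.
split; first by rewrite /C => hc m n; case: asboolP.
move=> n hn d Omega P y hind hlaw K hconv hK hat hmeas hmin d' Omega' Q xi hxi t ht.
set bad := [set w | _]; set Kt := K `&` _.
have r0 : 0 < t ^+ 2 by rewrite exprn_gt0.
have mbad : measurable bad by exact: measurable_Delta2_gt.
have Ktth : Kt (theta n).
  by split => //=; rewrite subrr Delta2_0 ltW.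
pose M := \sum_i `|theta n 0 i| + (1 + t ^+ 2).
have KtM v : Kt v -> forall i, `|v 0 i| <= M.
  by move=> [_ /= vr] i; exact: Delta2_ball_bound.
have finP : P bad = (fine (P bad))%:E by rewrite fineK // fin_num_measure.
(* A real lower bound [x] for the width suffices, and keeps a possibly infinite width out of the
   arithmetic. *)
suff : exists2 x, fine (P bad) <= x * (t ^+ 2)^-1 * C n &
    (x%:E <= rademacher_width xi Kt)%E.
  move=> [x xP xRW]; rewrite finP.
  apply: (@le_trans _ _ (x * (t ^+ 2)^-1 * C n)%:E).
    by rewrite lee_fin.
  rewrite mulrC EFinM lee_wpmul2l //.
    by rewrite lee_fin ltW.
  by rewrite EFinM lee_wpmul2r // lee_fin invr_ge0 ltW.
rewrite /C; case: asboolP => [hc|_].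
  (* The value for which the first inequality is an equality with constant [2 / c]. *)
  exists (c * t ^+ 2 * fine (P bad) / 2).
    rewrite le_eqVlt; apply/orP; left; apply/eqP; field.
    by rewrite (gt_eqF c0) (gt_eqF ht).
  apply: (rademacher_width_ge_sup (M := M)) => //; first by exists (theta n).
  move=> h hh; rewrite ler_pdivrMr // mulrC [leRHS]mulrC.
  have := @quantile_regression_tail R tau L f n (mu n) (theta n) d Omega P y K
    hat t h _ L0 f0 (hc n) _ hind hlaw hconv hK hmeas hmin.
  rewrite -/c -/bad mulrC; apply.
  - by rewrite !ltW.
  - move=> i u uL; have := hLf n hn (const_mx u) _ i.
    by rewrite mxE; apply; apply: le_trans uL; exact: mx_norm_const_le.
  - by move=> v s Kv vr; apply: hh.
have Pbad1 : fine (P bad) <= 1.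
  by rewrite -lee_fin -finP probability_le1.
have [[w bw]|nbad] := pselect (bad !=set0); last first.
  have -> : bad = set0 by apply/seteqP; split => w //= bw; apply: nbad; exists w.
  (* The width is nonnegative: the two points are both taken to be [theta n]. *)
  exists 0; first by rewrite measure0 !mul0r.
  have := rademacher_width_ge_Delta2 hn hxi KtM Ktth Ktth.
  by rewrite subrr Delta2_0 mul0r.
have [v [Kv vr _]] := check_loss_basic hconv hK (hmin w) bw.
(* Multiplied by [2 * n.+1%:R / t ^+ 2] this is (n+1)/n, at least 1 and so at least the
   probability. *)
exists (t ^+ 2 / (2 * n%:R)); last first.
  by rewrite -vr; apply: rademacher_width_ge_Delta2 (KtM) _ _ => //; split;
     rewrite //= vr.
apply: le_trans Pbad1 _.
have n1 : 0 < n%:R :> R by rewrite ltr0n.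
have -> : t ^+ 2 / (2 * n%:R) * (t ^+ 2)^-1 * (2 * n.+1%:R) = n.+1%:R / n%:R.
  by field; rewrite (gt_eqF n1) (gt_eqF ht).
by rewrite ler_pdivlMr // mul1r ler_nat.
Qed.
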